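(* Let $q$ be a prime with $q\equiv 3 \pmod 4$ and $m\ge 1$ an integer. Then the zero-divisor graph $\Gamma(\mathbb{Z}_{q^m}[i])$ is pancyclic if and only if $m=2$.
   Context: $\mathbb{Z}_n[i]=\mathbb{Z}[i]/\langle n\rangle=\{a+bi : a,b\in\mathbb{Z}_n\}$ with $i^2=-1$. For a finite commutative ring $R$ with unity, $\Gamma(R)$ has vertex set the nonzero zero-divisors of $R$, distinct $x,y$ adjacent iff $xy=0$. A graph of order $N$ is pancyclic if $N\ge 3$ and it contains a cycle of length $k$ for every $3\le k\le N$. *)

(* Defs.v *)
From HB Require Import structures.
From mathcomp Require Import all_boot all_order all_algebra.
From mathcomp Require Import ring.
Set Implicit Arguments.
Unset Strict Implicit.
Unset Printing Implicit Defensive.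
Import GRing.Theory.
Local Open Scope ring_scope.

(* [ZnGauss a b] stands for a + b i.  Since ['Z_n] is the ring of integers
   mod n only for n > 1, so is [Zn_gauss n] the ring Z_n[i]. *)
Record Zn_gauss (n : nat) : Type := ZnGauss { gRe : 'Z_n; gIm : 'Z_n }.

Section ZnGaussRing.
Variable n : nat.
Implicit Types x y z : Zn_gauss n.

Definition pair_of_gauss x : 'Z_n * 'Z_n := (gRe x, gIm x).
Definition gauss_of_pair (p : 'Z_n * 'Z_n) : Zn_gauss n := ZnGauss p.1 p.2.
Lemma pair_of_gaussK : cancel pair_of_gauss gauss_of_pair.
Proof. by case. Qed.

HB.instance Definition _ := Equality.copy (Zn_gauss n) (can_type pair_of_gaussK).
HB.instance Definition _ := Choice.copy (Zn_gauss n) (can_type pair_of_gaussK).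
HB.instance Definition _ := Countable.copy (Zn_gauss n) (can_type pair_of_gaussK).
HB.instance Definition _ : isFinite (Zn_gauss n) := CanIsFinite pair_of_gaussK.

Definition gauss_zero : Zn_gauss n := ZnGauss 0 0.
Definition gauss_one : Zn_gauss n := ZnGauss 1 0.
Definition gauss_opp x : Zn_gauss n := ZnGauss (- gRe x) (- gIm x).
Definition gauss_add x y : Zn_gauss n :=
  ZnGauss (gRe x + gRe y) (gIm x + gIm y).
Definition gauss_mul x y : Zn_gauss n :=
  ZnGauss (gRe x * gRe y - gIm x * gIm y) (gRe x * gIm y + gIm x * gRe y).

Lemma gauss_addA : associative gauss_add.
Proof. by move=> [a b] [c d] [e f]; rewrite /gauss_add /= !addrA. Qed.
Lemma gauss_addC : commutative gauss_add.
Proof.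
by move=> [a b] [c d]; rewrite /gauss_add /= (addrC a) (addrC b).
Qed.
Lemma gauss_add0 : left_id gauss_zero gauss_add.
Proof. by move=> [a b]; rewrite /gauss_add /= !add0r. Qed.
Lemma gauss_addN : left_inverse gauss_zero gauss_opp gauss_add.
Proof. by move=> [a b]; rewrite /gauss_add /= !addNr. Qed.
HB.instance Definition _ := GRing.isZmodule.Build (Zn_gauss n)
  gauss_addA gauss_addC gauss_add0 gauss_addN.

Lemma gauss_mulA : associative gauss_mul.
Proof.
by move=> [a b] [c d] [e f]; rewrite /gauss_mul /=; congr ZnGauss; ring.
Qed.
Lemma gauss_mulC : commutative gauss_mul.
Proof. by move=> [a b] [c d]; rewrite /gauss_mul /=; congr ZnGauss; ring. Qed.
Lemma gauss_mul1 : left_id gauss_one gauss_mul.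
Proof. by move=> [a b]; rewrite /gauss_mul /=; congr ZnGauss; ring. Qed.
Lemma gauss_mulDl : left_distributive gauss_mul gauss_add.
Proof.
move=> [a b] [c d] [e f]; rewrite /gauss_mul /gauss_add /=.
by congr ZnGauss; ring.
Qed.
Lemma gauss_one_neq0 : gauss_one != gauss_zero.
Proof. by apply/eqP=> /(congr1 (@gRe n))/eqP; rewrite oner_eq0. Qed.
HB.instance Definition _ := GRing.Zmodule_isComNzRing.Build (Zn_gauss n)
  gauss_mulA gauss_mulC gauss_mul1 gauss_mulDl gauss_one_neq0.

Lemma gauss_i_sqr : (ZnGauss 0 1 : Zn_gauss n) ^+ 2 = -1.
Proof.
by rewrite expr2; rewrite [LHS]/(gauss_mul _ _) [RHS]/(gauss_opp _)
  /gauss_mul /gauss_opp /=; congr ZnGauss; ring.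
Qed.

End ZnGaussRing.

Record sgraph : Type := SGraph {
  svertex : finType;
  sedge : rel svertex;
  sedge_sym : symmetric sedge;
  sedge_irr : irreflexive sedge }.

(* In a simple graph, a duplicate-free closed walk [ucycle] through k >= 3
   vertices is exactly a cycle of length k. *)
Definition has_cycle (G : sgraph) (k : nat) : Prop :=
  exists s : seq (svertex G), ucycle (@sedge G) s /\ size s = k.

Definition pancyclic (G : sgraph) : Prop :=
  (3 <= #|svertex G|)%N /\
  forall k : nat, (3 <= k <= #|svertex G|)%N -> has_cycle G k.

Section ZeroDivisorGraph.
Variable R : finComNzRingType.

Definition zero_divisor (x : R) : bool := [exists y : R, (y != 0) && (x * y == 0)].

Definition zdg_vertex : finType := {x : R | (x != 0) && zero_divisor x}.

Definition zdg_edge : rel zdg_vertex :=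
  fun x y => (x != y) && (val x * val y == 0).

Lemma zdg_edge_sym : symmetric zdg_edge.
Proof. by move=> x y; rewrite /zdg_edge eq_sym mulrC. Qed.

Lemma zdg_edge_irr : irreflexive zdg_edge.
Proof. by move=> x; rewrite /zdg_edge eqxx. Qed.

Definition zero_divisor_graph : sgraph := SGraph zdg_edge_sym zdg_edge_irr.

End ZeroDivisorGraph.

(* Main.v *)
Require Import Defs.
From mathcomp Require Import all_boot all_order all_algebra.
From mathcomp Require Import finfield.
From mathcomp Require Import ring zify.

(** Since -1 is not a square mod q, the norm shows that every zero-divisor of
    R = Z_{q^m}[i] is a multiple of q.  For m = 1 the graph is therefore empty,
    and for m = 2 it is complete.  For m >= 3 the vertices not divisible by q^2
    are independent, and z |-> z + q injects the remaining vertices into them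
    while missing q itself: an independent set containing more than half of the
    vertices excludes a Hamiltonian cycle. *)

Set Implicit Arguments.
Unset Strict Implicit.
Unset Printing Implicit Defensive.
Import GRing.Theory.
Local Open Scope ring_scope.

Lemma uniq_cycle_neq (T : eqType) (s : seq T) :
  (1 < size s)%N -> uniq s -> cycle [rel x y | x != y] s.
Proof.
case: s => [|x [|y p]] // _ /[dup] + /andP[xNyp _].
rewrite uniq_pairwise => /pairwise_sorted xyp.
(* The closing edge joins the last element to the head, which does not recur in the nonempty
   tail. *)
rewrite /cycle rcons_path; apply/andP; split; first exact: xyp.
by apply: contraNneq xNyp => /= e; rewrite -[X in X \in _]e mem_last.
Qed.

Lemma complete_has_cycle (G : sgraph) (k : nat) :
  (forall x y : svertex G, x != y -> sedge x y) ->
  (2 <= k <= #|svertex G|)%N -> has_cycle G k.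
Proof.
move=> Gcomplete /andP[k_ge2 k_le].
have sz : size (take k (enum (svertex G))) = k.
  by rewrite size_takel // -cardE.
have us : uniq (take k (enum (svertex G))) by rewrite take_uniq ?enum_uniq.
exists (take k (enum (svertex G))); split=> //; rewrite /ucycle us andbT.
by apply: sub_cycle (uniq_cycle_neq _ us) => [x y /Gcomplete|]; rewrite ?sz.
Qed.

(** The successor map along a Hamiltonian cycle is injective, and it sends [S] into its complement
    because each vertex is adjacent to its successor. *)
Lemma hamiltonian_independent (G : sgraph) (S : {set svertex G}) :
  has_cycle G #|svertex G| -> {in S &, forall x y, ~~ sedge x y} ->
  (#|S| <= #|~: S|)%N.
Proof.
move=> [s [/andP[cyc_s us] sz]] Sind.
have ins x : x \in s.
  have /subset_leqif_card[_ +] : s \subset svertex G by apply/subsetP.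
  by rewrite (card_uniqP us) sz eqxx => /esym/subsetP->.
have inj : injective (next s) by exact: can_inj (prev_next us).
rewrite -(card_imset _ inj) subset_leq_card //.
apply/subsetP => _ /imsetP[x xS ->]; rewrite inE.
by apply/negP => /(Sind _ _ xS); rewrite next_cycle.
Qed.

Section NilpotentGenerator.
Variables (R : finComNzRingType) (t : R).
(** The element [t] stands for q in Z_{q^m}[i]; its nilpotency index governs the shape of the
    graph. *)
Hypothesis zd_dvd : forall x : R, zero_divisor x -> exists y, x = t * y.

Lemma zdg_gen0 : t = 0 -> #|zdg_vertex R| = 0%N.
Proof.
move=> t0; apply/eqP; rewrite -leqn0 leqNgt; apply/card_gt0P => -[x _].
have /andP[+ /zd_dvd[y xE]] := valP x.
by rewrite xE t0 mul0r eqxx.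
Qed.

Lemma zdg_complete (x y : zdg_vertex R) : t ^+ 2 = 0 -> x != y -> zdg_edge x y.
Proof.
move=> t2 xy; rewrite /zdg_edge xy /=.
have /andP[_ /zd_dvd[a ->]] := valP x; have /andP[_ /zd_dvd[b ->]] := valP y.
by rewrite mulrACA -expr2 t2 mul0r.
Qed.

Variable m : nat.
Hypotheses (m_ge3 : (3 <= m)%N) (tm0 : t ^+ m = 0) (tm1 : t ^+ m.-1 != 0).

(** Multiplying t = t^2 y by t^(m-2) would give t^(m-1) = t^m y = 0. *)
Lemma gen_neq_sqr_mul (y : R) : t != t ^+ 2 * y.
Proof.
apply: contraNneq tm1 => tE; have -> : m.-1 = (m - 2).+1 by lia.
by rewrite exprSr [X in _ * X]tE mulrA -exprD subnK 1?ltnW // tm0 mul0r.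
Qed.

Lemma zdg_no_hamiltonian : ~ has_cycle (zero_divisor_graph R) #|zdg_vertex R|.
Proof.
pose S := [set x : zdg_vertex R | ~~ [exists y, val x == t ^+ 2 * y]].
(* Non-multiples of [t] are not zero-divisors, so they can be cancelled. *)
have reg (x y : R) : (forall w, x != t * w) -> x * y = 0 -> y = 0.
  move=> xN xy0; apply/eqP; apply: contraT => y0.
  have /zd_dvd[w xE] : zero_divisor x by apply/existsP; exists y; rewrite y0 xy0 /=.
  by have := xN w; rewrite xE eqxx.
have nS (a : R) : ~~ [exists y, t * a == t ^+ 2 * y] -> forall w, a != t * w.
  move=> + w; apply: contraNneq => ->; apply/existsP.
  by exists w; rewrite mulrA -expr2.
have Sind : {in S &, forall x y, ~~ zdg_edge x y}.
  move=> x y; have /andP[_ /zd_dvd[a xE]] := valP x.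
  have /andP[_ /zd_dvd[b yE]] := valP y.
  rewrite !inE /zdg_edge negb_and xE yE => /nS aN /nS bN.
  apply/orP; right; apply: contraNneq tm1 => ab0.
  (* From t^2 a b = 0, cancelling [a] and then [b] leaves t^2 = 0, hence t^(m-1) = 0 because m - 1
     >= 2. *)
  have/(reg _ _ aN)/(reg _ _ bN) t2: a * (b * t ^+ 2) = 0 by rewrite -ab0; ring.
  have -> : m.-1 = (2 + (m - 3))%N by lia.
  by rewrite exprD t2 mul0r.
have vtx (w : R) : (t + t ^+ 2 * w != 0) && zero_divisor (t + t ^+ 2 * w).
  apply/andP; split.
    by rewrite addr_eq0 -mulrN gen_neq_sqr_mul.
  (* The power t^(m-1) is nonzero and annihilates every multiple of [t]. *)
  apply/existsP; exists (t ^+ m.-1); rewrite tm1 /=.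
  have -> : (t + t ^+ 2 * w) * t ^+ m.-1 = t * t ^+ m.-1 * (1 + t * w) by ring.
  by rewrite -exprS prednK ?tm0 ?mul0r //; lia.
pose v (w : R) : zdg_vertex R := exist _ (t + t ^+ 2 * w) (vtx w).
have inS (w : R) : v w \in S.
  rewrite inE /=; apply/existsP => -[y /eqP e].
  by have := gen_neq_sqr_mul (y - w); rewrite mulrBr -e addrK eqxx.
(* The default [z] is never reached off [S]: there z = t^2 w, and t + z is the vertex [v w]. *)
pose f (z : zdg_vertex R) : zdg_vertex R := insubd z (t + val z).
have fS z : z \notin S -> val (f z) = t + val z /\ f z \in S.
  rewrite inE negbK => /existsP[w /eqP zE]; rewrite /f zE.
  have -> : insubd z (t + t ^+ 2 * w) = v w.
    by apply: val_inj; rewrite insubdK //; exact: vtx.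
  by rewrite inS.
have lt_card : (#|~: S| < #|S|)%N.
  have injf : {in ~: S &, injective f}.
    move=> x y /[!in_setC] /fS[fx _] /fS[fy _] /(congr1 val).
    by rewrite fx fy => /addrI/val_inj.
  rewrite -(card_in_imset injf); apply: proper_card; apply/properP; split.
    by apply/subsetP => _ /imsetP[z /[!in_setC] zS ->]; case: (fS z zS).
  (* The vertex [v 0] is [t] itself; its only possible preimage is 0, which is not a vertex. *)
  exists (v 0); first exact: inS.
  apply/imsetP => -[z /[!in_setC] zS /(congr1 val)].
  case: (fS z zS) => -> _; rewrite /= mulr0 => /addrI/esym z0.
  by have := valP z; rewrite [\val z]z0 eqxx.
by move=> /hamiltonian_independent/(_ Sind); rewrite leqNgt lt_card.
Qed.

End NilpotentGenerator.

(** Otherwise a^2 = -b^2 with both sides nonzero in F_q, which contradicts Fermat's little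
    theorem. *)
Lemma prime_dvd_sum_sqr (q a b : nat) :
  prime q -> q = 3 %[mod 4] -> (q %| a ^ 2 + b ^ 2)%N -> (q %| a)%N.
Proof.
move=> pq q4 dvd_ab; apply: contraT => Nqa.
have cq := pchar_Fp pq.
have Fq k : ((k%:R : 'F_q) == 0) = (q %| k)%N by rewrite (dvdn_pcharf cq).
have fermat k : ~~ (q %| k)%N -> (k%:R : 'F_q) ^+ q.-1 = 1.
  rewrite -Fq => k0; apply: (mulfI k0); rewrite -exprS mulr1 prednK ?prime_gt0 //.
  by rewrite -[X in _ ^+ X](card_Fp pq) expf_card.
have Nqb : ~~ (q %| b)%N.
  apply: contraNN Nqa => qb.
  by move: dvd_ab; rewrite dvdn_addl !Euclid_dvdX // ?andbT // qb.
have e : (a%:R : 'F_q) ^+ 2 = - b%:R ^+ 2.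
  by apply/eqP; rewrite -addr_eq0 -!natrX -natrD Fq.
(* (q - 1)/2 is odd, so this power of a^2 = -b^2 reads 1 = -1. *)
have qE : q.-1 = (2 * (2 * (q %/ 4)).+1)%N by lia.
have := congr1 (fun z => z ^+ (2 * (q %/ 4)).+1) e.
rewrite /= exprNn -!exprM -qE !fermat // mulr1 exprS exprM sqrrN !expr1n mulr1.
move/eqP; rewrite -addr_eq0 -mulr2n Fq.
by rewrite dvdn_prime2 // => /eqP q2; rewrite q2 in q4.
Qed.

Section GaussMod.
Variable n : nat.

Lemma gauss_eqE (a b c d : 'Z_n) :
  (ZnGauss a b == ZnGauss c d) = (a == c) && (b == d).
Proof. by []. Qed.

Lemma gauss_natr (k : nat) : k%:R = ZnGauss k%:R 0 :> Zn_gauss n.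
Proof.
elim: k => [|k IHk] //; rewrite -natr1 IHk.
by rewrite [LHS]/(gauss_add _ _) /gauss_add /= natr1 addr0.
Qed.

Lemma gauss_mulE (x y : Zn_gauss n) : x * y =
  ZnGauss (gRe x * gRe y - gIm x * gIm y) (gRe x * gIm y + gIm x * gRe y).
Proof. by []. Qed.

Lemma gauss_natr_mul (k : nat) (a b : 'Z_n) :
  k%:R * ZnGauss a b = ZnGauss (k%:R * a) (k%:R * b).
Proof. by rewrite gauss_natr gauss_mulE /= !mul0r subr0 addr0. Qed.

Hypothesis n_gt1 : (1 < n)%N.

Lemma Zn_natr_eq0 (k : nat) : ((k%:R : 'Z_n) == 0) = (n %| k)%N.
Proof. by rewrite -val_eqE /= val_Zp_nat. Qed.

Lemma gauss_natr_eq0 (k : nat) : ((k%:R : Zn_gauss n) == 0) = (n %| k)%N.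
Proof.
by rewrite -Zn_natr_eq0 gauss_natr; apply/eqP/eqP => [/(congr1 (@gRe _))|->].
Qed.

End GaussMod.

(** If q does not divide the norm of [x], the norm is a unit mod q^m, and multiplying x y = 0 by the
    conjugate of [x] forces y = 0. *)
Lemma zero_divisor_gauss_dvd (q m : nat) (x : Zn_gauss (q ^ m)) :
  prime q -> q = 3 %[mod 4] -> (0 < m)%N -> zero_divisor x ->
  exists y, x = q%:R * y.
Proof.
move=> pq q4 m_gt0 /existsP[[c d] /andP[y0 /eqP xy0]].
have n_gt1 : (1 < q ^ m)%N by rewrite -(exp1n m) ltn_exp2r // prime_gt1.
case: x xy0 => a b; rewrite gauss_mulE /= => xy0.
have re0 : a * c - b * d = 0 := congr1 (@gRe _) xy0.
have im0 : a * d + b * c = 0 := congr1 (@gIm _) xy0.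
have dvd_norm : (q %| (a : nat) ^ 2 + (b : nat) ^ 2)%N.
  apply: contraNT y0; rewrite -prime_coprime // => cop.
  have u : (a ^+ 2 + b ^+ 2 : 'Z_(q ^ m)) \is a GRing.unit.
    rewrite -(natr_Zp a) -(natr_Zp b) -!natrX -natrD unitZpE //.
    exact: coprimeXl.
  have c0 : c = 0.
    apply: (mulrI u); rewrite mulr0.
    (* This is the real part of (a - bi)(xy); the imaginary part gives [d0] in the same way. *)
    transitivity (a * (a * c - b * d) + b * (a * d + b * c)); first by ring.
    by rewrite re0 im0 !mulr0 addr0.
  have d0 : d = 0.
    apply: (mulrI u); rewrite mulr0.
    transitivity (a * (a * d + b * c) - b * (a * c - b * d)); first by ring.
    by rewrite re0 im0 !mulr0 subr0.
  by rewrite c0 d0.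
have qa := prime_dvd_sum_sqr pq q4 dvd_norm.
have qb : (q %| b)%N by apply: (prime_dvd_sum_sqr (b := a) pq q4); rewrite addnC.
exists (ZnGauss ((a : nat) %/ q)%:R ((b : nat) %/ q)%:R).
by rewrite gauss_natr_mul -!natrM ![(q * _)%N]mulnC !divnK // !natr_Zp.
Qed.

Lemma zdg_gauss_sqr_card (q : nat) :
  prime q -> (3 <= #|zdg_vertex (Zn_gauss (q ^ 2))|)%N.
Proof.
move=> pq; have n_gt1 : (1 < q ^ 2)%N by rewrite -(exp1n 2) ltn_exp2r // prime_gt1.
have q0 : (q%:R : 'Z_(q ^ 2)) != 0.
  by rewrite Zn_natr_eq0 // gtnNdvd ?prime_gt0 // ltn_Pmulr ?prime_gt1 ?prime_gt0.
have qq : (q%:R * q%:R : Zn_gauss (q ^ 2)) = 0.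
  by apply/eqP; rewrite -natrM gauss_natr_eq0.
(* The elements q, qi and q + qi are distinct, nonzero and annihilated by q. *)
pose s : seq (Zn_gauss (q ^ 2)) :=
  [:: ZnGauss q%:R 0; ZnGauss 0 q%:R; ZnGauss q%:R q%:R].
have us : uniq s.
  by rewrite /= !inE !gauss_eqE !(eq_sym 0) (negPf q0) /= andbF.
have sV : {subset s <= [pred x | (x != 0) && zero_divisor x]}.
  have zd a b : zero_divisor (ZnGauss (q%:R * a) (q%:R * b) : Zn_gauss (q ^ 2)).
    apply/existsP; exists q%:R; rewrite -gauss_natr_mul mulrAC qq mul0r eqxx andbT.
    by rewrite gauss_natr gauss_eqE (negPf q0).
  have := (zd 1 0, zd 0 1, zd 1 1); rewrite mulr1 mulr0 => zds.
  by move=> x; rewrite !inE => /or3P[]/eqP->;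
    rewrite zds gauss_eqE (negPf q0) ?andbF.
rewrite card_sig -[3%N]/(size s) -(card_uniqP us) subset_leq_card //.
exact/subsetP.
Qed.

Local Close Scope ring_scope.

Theorem theorem2p2 (q m : nat) (hq : prime q) (hq4 : q = 3 %[mod 4])
    (hm : 1 <= m) :
  pancyclic (zero_divisor_graph (Zn_gauss (q ^ m))) <-> m = 2.
Proof.
have dvd x := @zero_divisor_gauss_dvd q m x hq hq4 hm.
have n_gt1 : (1 < q ^ m)%N by rewrite -(exp1n m) ltn_exp2r // prime_gt1.
have qm0 : ((q%:R : Zn_gauss (q ^ m)) ^+ m = 0)%R.
  by apply/eqP; rewrite -natrX gauss_natr_eq0.
split=> [[/= card_ge3 cyc]|m2].
  case: (ltngtP m 2) => // m_cmp.
    have m1 : m = 1%N by lia.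
    (* Here q = q^m = 0, so the graph has no vertices. *)
    by rewrite (zdg_gen0 dvd) // -[LHS]expr1 -[in LHS]m1 in card_ge3.
  have qm1 : ((q%:R : Zn_gauss (q ^ m)) ^+ m.-1 != 0)%R.
    rewrite -natrX gauss_natr_eq0 // dvdn_Pexp2l ?prime_gt1 //; lia.
  (* Pancyclicity at k equal to the order of the graph provides a Hamiltonian cycle. *)
  by case: (zdg_no_hamiltonian dvd m_cmp qm0 qm1); apply: cyc; rewrite card_ge3 /=.
split=> [|k /andP[k_ge3 k_le]]; first by rewrite m2; exact: zdg_gauss_sqr_card.
apply: complete_has_cycle => [x y|]; last by rewrite ltnW.
by apply: (zdg_complete dvd); rewrite -[in LHS]m2.
Qed.
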